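(* Let $E$ be a complete local ring with residue field of characteristic $p>0$, let $F$ be a (one-dimensional commutative) formal group law over $E$, and let $R=E[[\hat q]]$. Consider, for complete local $R$-algebras $A$, the groups $F(A)$, $\mathrm{Tate}(F)(A)$ and $F(A)/(\hat q)$. Then projection onto the first factor, $F(A)\times\mathbb{Q}\to F(A)$, induces a natural transformation $$\mathrm{Tate}(F)_{\mathrm{tors}}(A)\to \big(F/(\hat q)\big)_{\mathrm{tors}}(A)$$ between torsion subgroups, which is an isomorphism whenever (the image of) $\hat q$ is not in the torsion subgroup $F(A)_{\mathrm{tors}}$ of $F(A)$.
   Context: For a complete local $R$-algebra $A$ with maximal ideal $\mathfrak m_A$, $F(A)$ denotes the set $\mathfrak m_A$ with the abelian group structure $+_F$ defined by $F$; the image of $\hat q$ lies in $\mathfrak m_A$, and $(\hat q)=\{[n]_F(\hat q):n\in\mathbb{Z}\}$ is the subgroup of $F(A)$ it generates. $F/(\hat q)$ is the group-valued functor $A\mapsto F(A)/(\hat q)$. $\mathrm{Tate}(F)$ is the formal group scheme over $R$ which is the disjoint union $\bigcup_{a\in\mathbb{Q}\cap[0,1)}F_R\times\{a\}$; thus $\mathrm{Tate}(F)(A)$ is the set of pairs $(g,a)$ with $g\in F(A)$, $a\in\mathbb{Q}\cap[0,1)$, with group law $$(g,a)\cdot(h,b)=\begin{cases}(g+_F h,\ a+b)& a+b<1,\\ (g+_F h-_F\hat q,\ a+b-1)& a+b\ge 1.\end{cases}$$ Equivalently, there is an exact sequence $$0\to\mathbb{Z}\to F(A)\times\mathbb{Q}\to\mathrm{Tate}(F)(A)\to0,$$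 with first map $n\mapsto([n]_F(\hat q),n)$ and second map $(x,a)\mapsto(x-_F[\flat(a)]_F(\hat q),\sharp(a))$, where $\flat(a)$ and $\sharp(a)$ are the integral and fractional parts of $a$. The subscript ''tors'' denotes the torsion subgroup. *)

(* Defs.v *)
From HB Require Import structures.
From mathcomp Require Import all_boot all_order all_algebra.
From mathcomp Require Import ring_quotient lra.
From mathcomp Require Import boolp classical_sets.

Set Implicit Arguments.
Unset Strict Implicit.
Unset Printing Implicit Defensive.

Import Order.TTheory GRing.Theory Num.Theory.
Local Open Scope ring_scope.

Record series (R : Type) := Series { scoef : nat -> R }.
Notation "{ 'series' R }" := (series R) (format "{ 'series'  R }") : type_scope.
Arguments scoef : simpl never.

HB.instance Definition _ (R : Type) := gen_eqMixin {series R}.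
HB.instance Definition _ (R : Type) := gen_choiceMixin {series R}.

Lemma seriesP (R : Type) (f g : {series R}) : scoef f =1 scoef g -> f = g.
Proof. by case: f g => [f] [g] /= /funext; rewrite /scoef => ->. Qed.

Lemma scoefE (R : Type) (f : nat -> R) i : scoef (Series f) i = f i.
Proof. by []. Qed.

Section SeriesZmod.
Variable R : zmodType.
Implicit Types f g : {series R}.

Definition series_zero : {series R} := Series (fun=> 0).
Definition series_opp f : {series R} := Series (fun i => - scoef f i).
Definition series_add f g : {series R} :=
  Series (fun i => scoef f i + scoef g i).

Fact series_addA : associative series_add.
Proof. by move=> f g h; apply: seriesP => i; rewrite !scoefE addrA. Qed.
Fact series_addC : commutative series_add.
Proof. by move=> f g; apply: seriesP => i; rewrite !scoefE addrC. Qed.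
Fact series_add0 : left_id series_zero series_add.
Proof. by move=> f; apply: seriesP => i; rewrite !scoefE add0r. Qed.
Fact series_addN : left_inverse series_zero series_opp series_add.
Proof. by move=> f; apply: seriesP => i; rewrite !scoefE addNr. Qed.

HB.instance Definition _ := GRing.isZmodule.Build {series R}
  series_addA series_addC series_add0 series_addN.

Definition scoefn i f := scoef f i.
Fact scoefn_is_zmod_morphism i : zmod_morphism (scoefn i).
Proof. by []. Qed.
HB.instance Definition _ i :=
  GRing.isZmodMorphism.Build {series R} R (scoefn i) (scoefn_is_zmod_morphism i).

Lemma scoef0 i : scoef (0 : {series R}) i = 0. Proof. by []. Qed.
Lemma scoefD f g i : scoef (f + g) i = scoef f i + scoef g i.
Proof. by []. Qed.
Lemma scoefN f i : scoef (- f) i = - scoef f i. Proof. by []. Qed.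
Lemma scoefB f g i : scoef (f - g) i = scoef f i - scoef g i.
Proof. by []. Qed.
Lemma scoef_sum I (r : seq I) (P : pred I) (F : I -> {series R}) i :
  scoef (\sum_(j <- r | P j) F j) i = \sum_(j <- r | P j) scoef (F j) i.
Proof. exact: (raddf_sum (scoefn i)). Qed.

Definition seriesC (c : R) : {series R} :=
  Series (fun i => if i is 0 then c else 0).

End SeriesZmod.

Section SeriesRing.
Variable R : comNzRingType.
Implicit Types f g : {series R}.

Definition series_one : {series R} := seriesC 1.
Definition series_mul f g : {series R} :=
  Series (fun n => \sum_(i < n.+1) scoef f i * scoef g (n - i)).

Definition series_trunc n f : {poly R} := \poly_(i < n) scoef f i.
Local Notation trunc := series_trunc.

Lemma coef_trunc n f i : (i < n)%N -> (trunc n f)`_i = scoef f i.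
Proof. by move=> lt_in; rewrite coef_poly lt_in. Qed.

Definition agree n (p : {poly R}) f := forall i, (i < n)%N -> p`_i = scoef f i.

Lemma agreeM n p q f g :
  agree n p f -> agree n q g -> agree n (p * q) (series_mul f g).
Proof.
move=> pf qg i lt_in; rewrite coefM scoefE; apply: eq_bigr => j _.
rewrite pf ?qg //; first exact: leq_ltn_trans (leq_subr _ _) lt_in.
exact: leq_trans (ltn_ord j) lt_in.
Qed.

Lemma agree_trunc n f : agree n (trunc n f) f.
Proof. by move=> i; apply: coef_trunc. Qed.

Fact series_mulA : associative series_mul.
Proof.
move=> f g h; apply: seriesP => i; have lt_i := ltnSn i.
have [Af Ag Ah] := And3 (@agree_trunc i.+1 f) (@agree_trunc i.+1 g)
  (@agree_trunc i.+1 h).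
rewrite -(agreeM Af (agreeM Ag Ah) lt_i) mulrA.
by rewrite (agreeM (agreeM Af Ag) Ah lt_i).
Qed.
Fact series_mulC : commutative series_mul.
Proof.
move=> f g; apply: seriesP => i; have lt_i := ltnSn i.
have [Af Ag] := conj (@agree_trunc i.+1 f) (@agree_trunc i.+1 g).
by rewrite -(agreeM Af Ag lt_i) mulrC (agreeM Ag Af lt_i).
Qed.
Fact series_mul1 : left_id series_one series_mul.
Proof.
move=> f; apply: seriesP => i; rewrite scoefE big_ord_recl /= mul1r subn0.
by rewrite big1 ?addr0 // => j _; rewrite mul0r.
Qed.
Fact series_mulDl : left_distributive series_mul +%R.
Proof.
move=> f g h; apply: seriesP => i; rewrite scoefD !scoefE -big_split /=.
by apply: eq_bigr => j _; rewrite mulrDl.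
Qed.
Fact series_one_neq0 : series_one != 0.
Proof.
apply/eqP => /(congr1 (fun f => scoef f 0)) /= /eqP.
by rewrite scoef0 scoefE oner_eq0.
Qed.

HB.instance Definition _ := GRing.Zmodule_isComNzRing.Build {series R}
  series_mulA series_mulC series_mul1 series_mulDl series_one_neq0.

Lemma scoefM f g n :
  scoef (f * g) n = \sum_(i < n.+1) scoef f i * scoef g (n - i).
Proof. by []. Qed.

Lemma scoef1 i : scoef (1 : {series R}) i = (i == 0)%:R.
Proof. by case: i. Qed.

Definition seriesX : {series R} := Series (fun i => (i == 1)%:R).

Fact seriesC_is_zmod_morphism : zmod_morphism (@seriesC R).
Proof.
by move=> c d; apply: seriesP => -[|i]; rewrite scoefB !scoefE ?subr0.
Qed.
Fact seriesC_is_monoid_morphism : monoid_morphism (@seriesC R).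
Proof.
split=> // c d; apply: seriesP => -[|i]; rewrite scoefM !scoefE.
  by rewrite big_ord1.
rewrite big_ord_recl /= mulr0 add0r big1 // => j _.
by rewrite mul0r.
Qed.
HB.instance Definition _ := GRing.isZmodMorphism.Build R {series R}
  (@seriesC R) seriesC_is_zmod_morphism.
HB.instance Definition _ := GRing.isMonoidMorphism.Build R {series R}
  (@seriesC R) seriesC_is_monoid_morphism.

Lemma scoefCM c f i : scoef (seriesC c * f) i = c * scoef f i.
Proof.
rewrite scoefM big_ord_recl /= subn0 big1 ?addr0 // => j _.
by rewrite mul0r.
Qed.

Definition series_unit f := `[< exists g, g * f = 1 >].
Definition series_inv f :=
  if pselect (exists g, g * f = 1) is left h then projT1 (cid h) else f.
Fact series_mulVx : {in series_unit, left_inverse 1 series_inv *%R}.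
Proof.
move=> f /asboolP h; rewrite /series_inv.
by case: pselect => // h'; case: cid.
Qed.
Fact series_unitPl f g : g * f = 1 -> series_unit f.
Proof. by move=> e; apply/asboolP; exists g. Qed.
Fact series_inv_out : {in [predC series_unit], series_inv =1 id}.
Proof.
by move=> f /asboolP h; rewrite /series_inv; case: pselect => // /h.
Qed.
HB.instance Definition _ := GRing.ComNzRing_hasMulInverse.Build {series R}
  series_mulVx series_unitPl series_inv_out.

End SeriesRing.

Arguments seriesX {R}.

Definition smap (R S : Type) (f : R -> S) (s : {series R}) : {series S} :=
  Series (fun i => f (scoef s i)).

Lemma scoef_map (R S : Type) (f : R -> S) s i :
  scoef (smap f s) i = f (scoef s i).
Proof. by []. Qed.

Section SeriesMap.
Variables (R S : comNzRingType) (f : {rmorphism R -> S}).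

Fact smap_is_zmod_morphism : zmod_morphism (smap f).
Proof. by move=> s t; apply: seriesP => i; rewrite scoef_map !scoefB rmorphB. Qed.
Fact smap_is_monoid_morphism : monoid_morphism (smap f).
Proof.
split=> [|s t]; apply: seriesP => i.
  by rewrite scoef_map !scoef1 rmorph_nat.
rewrite scoef_map !scoefM rmorph_sum; apply: eq_bigr => j _.
by rewrite rmorphM.
Qed.
HB.instance Definition _ := GRing.isZmodMorphism.Build {series R} {series S}
  (smap f) smap_is_zmod_morphism.
HB.instance Definition _ := GRing.isMonoidMorphism.Build {series R} {series S}
  (smap f) smap_is_monoid_morphism.

Lemma smapC c : smap f (seriesC c) = seriesC (f c).
Proof. by apply: seriesP => -[|i]; rewrite scoef_map !scoefE ?rmorph0. Qed.
Lemma smapX : smap f seriesX = seriesX.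
Proof. by apply: seriesP => i; rewrite scoef_map !scoefE rmorph_nat. Qed.
End SeriesMap.

Section IdealPowers.
Variable A : comNzRingType.

Definition ideal_prod (I J : A -> Prop) (x : A) : Prop :=
  exists n (a b : 'I_n -> A),
    [/\ forall i, I (a i), forall i, J (b i) & x = \sum_i a i * b i].

Fixpoint ideal_exp (I : A -> Prop) n : A -> Prop :=
  if n is n'.+1 then ideal_prod I (ideal_exp I n') else fun=> True.

End IdealPowers.

HB.mixin Record isLocal A of GRing.ComUnitRing A := {
  nonunitD : forall x y : A, x \isn't a GRing.unit -> y \isn't a GRing.unit ->
    x + y \isn't a GRing.unit }.

#[short(type="localRingType")]
HB.structure Definition LocalRing := {A of GRing.ComUnitRing A & isLocal A}.

(* The nonunits; by [ideal_sub_max] they contain every proper ideal. *)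
Definition max_ideal (A : localRingType) : {pred A} :=
  [pred x | x \isn't a GRing.unit].
Arguments max_ideal : clear implicits.

Section LocalRing.
Variable A : localRingType.

Lemma max_idealE (x : A) : (x \in max_ideal A) = (x \isn't a GRing.unit).
Proof. by []. Qed.

Fact max_ideal_closed : idealr_closed (max_ideal A).
Proof.
split; rewrite ?max_idealE ?unitr0 ?unitr1 // => a x y.
rewrite !max_idealE => xM yM; apply: nonunitD => //.
by rewrite unitrM negb_and xM orbT.
Qed.
HB.instance Definition _ := isIdealr.Build A (max_ideal A) max_ideal_closed.

Lemma ideal_sub_max (I : idealr A) : {subset I <= max_ideal A}.
Proof.
move=> x xI; rewrite max_idealE; apply/negP => Ux.
by have := idealMr x^-1 xI; rewrite mulVr // idealr1.
Qed.

Definition residue_field := {ideal_quot (max_ideal A)}.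
HB.instance Definition _ := GRing.ComNzRing.on residue_field.

Definition max_exp n : A -> Prop := ideal_exp (fun x => x \in max_ideal A) n.

End LocalRing.
Arguments max_exp : clear implicits.
Arguments residue_field : clear implicits.

(* The canonical map from A to the inverse limit of the A / m^n is injective and
   surjective: a compatible family of classes is given by representatives u. *)
HB.mixin Record isAdicComplete A of LocalRing A := {
  adic_separated : forall x : A, (forall n, max_exp A n x) -> x = 0;
  adic_complete : forall u : nat -> A,
    (forall n, max_exp A n (u n.+1 - u n)) ->
    exists l, forall n, max_exp A n (l - u n) }.

#[short(type="completeLocalRingType")]
HB.structure Definition CompleteLocalRing :=
  {A of LocalRing A & isAdicComplete A}.

Definition local_hom (A B : localRingType) (f : A -> B) : Prop :=
  forall x, x \in max_ideal A -> f x \in max_ideal B.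

HB.mixin Record isLocalAlgebra (R : localRingType) A
    of LocalRing A & GRing.ComUnitAlgebra R A := {
  in_alg_local : forall c : R, c \in max_ideal R -> c%:A \in max_ideal A }.

#[short(type="completeLocalAlgType")]
HB.structure Definition CompleteLocalAlgebra (R : localRingType) :=
  {A of CompleteLocalRing A & GRing.ComUnitAlgebra R A & isLocalAlgebra R A}.

Section SeriesLocal.
Variable E : localRingType.
Implicit Types f g : {series E}.

Section Inverse.
Variable f : {series E}.
Hypothesis Uf0 : scoef f 0 \is a GRing.unit.
Let c := (scoef f 0)^-1.
Let r := 1 - seriesC c * f.
Let app n := \sum_(i < n) r ^+ i.
Let lim_app := Series (fun n => scoef (app n.+1) n).

Let scoef_rX n i : (i < n)%N -> scoef (r ^+ n) i = 0.
Proof.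
elim: n i => // n IHn i lt_in; rewrite exprS scoefM big_ord_recl /=.
rewrite {1}/r scoefB scoefCM scoef1 mulVr // subrr mul0r add0r.
by rewrite big1 // => j _; rewrite IHn ?mulr0 //= /bump /=; case: i lt_in j => [|i] lt_in [j lt_j] //=; rewrite subSS (leq_ltn_trans (leq_subr _ _)).
Qed.

Let scoef_app n i : (i < n)%N -> scoef (app n) i = scoef lim_app i.
Proof.
elim: n => // n IHn; rewrite ltnS leq_eqVlt => /predU1P[-> //|lt_in].
by rewrite /app big_ord_recr /= scoefD scoef_rX // addr0 IHn.
Qed.

Lemma series_unit_coef0 : f \is a GRing.unit.
Proof.
suff e : seriesC c * lim_app * f = 1 by apply/asboolP; exists (seriesC c * lim_app).
have -> : seriesC c * lim_app * f = (1 - r) * lim_app.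
  by rewrite /r subKr mulrAC.
apply: seriesP => n.
have -> : scoef ((1 - r) * lim_app) n = scoef ((1 - r) * app n.+1) n.
  rewrite !scoefM; apply: eq_bigr => i _.
  by rewrite (@scoef_app n.+1) // ltnS leq_subr.
have -> : (1 - r) * app n.+1 = 1 - r ^+ n.+1.
  rewrite -[in RHS](expr1n _ n.+1) subrXX.
  by congr (_ * _); apply: eq_bigr => i _; rewrite expr1n mul1r.
by rewrite scoefB scoef_rX // subr0.
Qed.
End Inverse.

Lemma series_unitE f : (f \is a GRing.unit) = (scoef f 0 \is a GRing.unit).
Proof.
apply/idP/idP => [/unitrP[g [e _]]|]; last exact: series_unit_coef0.
have := congr1 (fun h => scoef h 0) e; rewrite /= scoefM big_ord1 scoef1 => e0.
by apply/unitrP; exists (scoef g 0); rewrite e0 mulrC e0.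
Qed.

Fact series_nonunitD f g : f \isn't a GRing.unit -> g \isn't a GRing.unit ->
  f + g \isn't a GRing.unit.
Proof. by rewrite !series_unitE; apply: nonunitD. Qed.
HB.instance Definition _ := isLocal.Build {series E} series_nonunitD.

Lemma seriesX_max : seriesX \in max_ideal {series E}.
Proof. by rewrite max_idealE series_unitE scoefE unitr0. Qed.

End SeriesLocal.

Section MaxExp.
Variable A : localRingType.
Implicit Types x y : A.
Local Notation m := (max_ideal A).
Local Notation mx := (max_exp A).

Lemma mx0 n : mx n 0.
Proof.
case: n => // n; exists 0, (fun=> 0), (fun=> 0); split; try by case.
by rewrite big_ord0.
Qed.

Lemma mxD n x y : mx n x -> mx n y -> mx n (x + y).
Proof.
case: n => // n [k [a [b [ma mb ->]]]] [k' [a' [b' [ma' mb' ->]]]].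
exists (k + k')%N.
exists (fun i => match split i with inl j => a j | inr j => a' j end).
exists (fun i => match split i with inl j => b j | inr j => b' j end).
split=> [i|i|]; try by case: split.
rewrite big_split_ord /=; congr (_ + _); apply: eq_bigr => i _.
  by rewrite (unsplitK (inl i)).
by rewrite (unsplitK (inr i)).
Qed.

Lemma mxMl n x y : mx n y -> mx n (x * y).
Proof.
case: n => // n [k [a [b [ma mb ->]]]].
exists k, (fun i => x * a i), b; split=> // [i|]; first exact: idealMr.
by rewrite mulr_sumr; apply: eq_bigr => i _; rewrite mulrA.
Qed.

Lemma mxMr n x y : mx n x -> mx n (x * y).
Proof. by rewrite mulrC; apply: mxMl. Qed.

Lemma mxN n x : mx n x -> mx n (- x).
Proof. by rewrite -mulN1r; apply: mxMl. Qed.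

Lemma mxB n x y : mx n x -> mx n y -> mx n (x - y).
Proof. by move=> mxx /mxN; apply: mxD. Qed.

Lemma mxBC n x y : mx n (x - y) -> mx n (y - x).
Proof. by move/mxN; rewrite opprB. Qed.

Lemma mx_trans n y x z : mx n (x - y) -> mx n (y - z) -> mx n (x - z).
Proof. by move=> xy yz; rewrite -(subrKA y) addrC addrC; apply: mxD. Qed.

Lemma mx_sum n I (r : seq I) (P : pred I) (F : I -> A) :
  (forall i, P i -> mx n (F i)) -> mx n (\sum_(i <- r | P i) F i).
Proof. by move=> mF; apply: big_ind => //; [apply: mx0 | apply: mxD]. Qed.

Lemma mxS n x y : x \in m -> mx n y -> mx n.+1 (x * y).
Proof.
move=> xm my; exists 1, (fun=> x), (fun=> y); split=> //.
by rewrite big_ord1.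
Qed.

Lemma mx1E x : mx 1 x <-> x \in m.
Proof.
split=> [[k [a [b [ma _ ->]]]]|xm]; last by rewrite -[x]mulr1; apply: mxS.
by apply: rpred_sum => i _; rewrite mulrC; apply: idealMr.
Qed.

Lemma mxX n x : x \in m -> mx n (x ^+ n).
Proof. by move=> xm; elim: n => // n IHn; rewrite exprS; apply: mxS. Qed.

Lemma mxW n x : mx n.+1 x -> mx n x.
Proof.
elim: n x => // n IHn x [k [a [b [ma mb ->]]]]; apply: mx_sum => i _.
by apply: mxS; [apply: ma | apply: IHn; apply: mb].
Qed.

Lemma mx_leq n k x : (n <= k)%N -> mx k x -> mx n x.
Proof.
move=> /subnK <-; elim: (k - n)%N => // d IHd; rewrite addSn => /mxW.
exact: IHd.
Qed.

Lemma mx_max n x : mx n.+1 x -> x \in m.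
Proof. by move/(@mx_leq 1) => /(_ isT)/mx1E. Qed.

Lemma mxXn n k x : (n <= k)%N -> x \in m -> mx n (x ^+ k).
Proof. by move=> le_nk xm; apply/(mx_leq le_nk)/mxX. Qed.

End MaxExp.

Lemma mx_map (A B : localRingType) (f : {rmorphism A -> B}) :
  local_hom f -> forall n x, max_exp A n x -> max_exp B n (f x).
Proof.
move=> fl; elim=> // n IHn x [k [a [b [ma mb ->]]]].
rewrite rmorph_sum; apply: mx_sum => i _; rewrite rmorphM; apply: mxS.
  exact/fl/ma.
exact/IHn/mb.
Qed.

Section SeriesComplete.
Variable E : completeLocalRingType.
Implicit Types f g : {series E}.

Lemma mx_scoef n f i : max_exp {series E} n f -> max_exp E (n - i) (scoef f i).
Proof.
elim: n f i => [|n IHn] f i; first by rewrite sub0n.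
move=> [k [a [b [ma mb ->]]]]; rewrite scoef_sum; apply: mx_sum => t _.
rewrite scoefM big_ord_recl subn0; apply: mxD.
  have a0 : scoef (a t) 0 \in max_ideal E.
    by have := ma t; rewrite !max_idealE series_unitE.
  apply: (@mx_leq _ _ (n - i).+1); last exact: mxS a0 (IHn _ _ (mb t)).
  by rewrite leq_subLR addnS ltnS -leq_subLR.
apply: mx_sum => j _; apply/mxMl/mx_leq/(IHn _ _ (mb t)).
case: i j => [[]//|i] j; rewrite /= /bump subSS subSS.
exact/leq_sub2l/leq_subr.
Qed.

Lemma scoef_mx n f : (forall i, (i < n)%N -> max_exp E (n - i) (scoef f i)) ->
  max_exp {series E} n f.
Proof.
elim: n f => // n IHn f mf; pose g := Series (fun i => scoef f i.+1).
have -> : f = seriesC (scoef f 0) + seriesX * g.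
  apply: seriesP => -[|i]; rewrite scoefD scoefM ?big_ord1 ?mul0r ?addr0 //.
  rewrite add0r !big_ord_recl mul0r add0r mul1r big1 ?addr0.
    by rewrite scoefE subSS subn0.
  by move=> j _; rewrite mul0r.
apply: mxD.
  apply: (mx_map (f := @seriesC E)); last exact: (mf 0).
  by move=> x; rewrite !max_idealE series_unitE.
by apply: mxS (seriesX_max E) (IHn _ _) => i lt_in; apply: (mf i.+1).
Qed.

Fact series_separated f : (forall n, max_exp {series E} n f) -> f = 0.
Proof.
move=> fm; apply: seriesP => i; apply: adic_separated => n.
by have := mx_scoef i (fm (n + i)%N); rewrite addnK.
Qed.

Fact series_complete (u : nat -> {series E}) :
  (forall n, max_exp {series E} n (u n.+1 - u n)) ->
  exists l, forall n, max_exp {series E} n (l - u n).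
Proof.
move=> uP; have lP i : exists l, forall n,
    max_exp E n (l - scoef (u (n + i)%N) i).
  apply: (adic_complete (fun n => scoef (u (n + i)%N) i)) => n.
  by have := mx_scoef i (uP (n + i)%N); rewrite addnK scoefB addSn.
exists (Series (fun i => projT1 (cid (lP i)))) => n; apply: scoef_mx => i lt_in.
rewrite scoefB scoefE; case: cid => l /= /(_ (n - i)%N).
by rewrite subnK // ltnW.
Qed.

HB.instance Definition _ :=
  isAdicComplete.Build {series E} series_separated series_complete.

End SeriesComplete.

Section Limits.
Variable A : completeLocalRingType.
Implicit Types (x y : A) (u : nat -> A).
Local Notation mx := (max_exp A).

Definition adic_lim u : A := xget 0 [set l | forall n, mx n (l - u n)].

Lemma adic_eq x y : (forall n, mx n (x - y)) -> x = y.
Proof. by move/adic_separated/eqP; rewrite subr_eq0 => /eqP. Qed.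

Lemma adic_limP u : (forall n, mx n (u n.+1 - u n)) ->
  forall n, mx n (adic_lim u - u n).
Proof.
by move=> /adic_complete[l ul]; rewrite /adic_lim; case: xgetP => [y _ //|/(_ l)].
Qed.

Definition seval x (f : {series A}) : A :=
  adic_lim (fun n => \sum_(i < n) scoef f i * x ^+ i).

Variable x : A.
Hypothesis xm : x \in max_ideal A.

Lemma sevalP f n : mx n (seval x f - \sum_(i < n) scoef f i * x ^+ i).
Proof.
apply: adic_limP => {}n; rewrite big_ord_recr /= addrAC subrr add0r.
exact/mxMl/mxX.
Qed.

Lemma sevalE f a : (forall n, mx n (a - \sum_(i < n) scoef f i * x ^+ i)) ->
  seval x f = a.
Proof.
move=> aP; apply: adic_eq => n; apply: (mx_trans (sevalP f n)).
exact/mxBC/aP.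
Qed.

Lemma seval_congr f g n : (forall i, (i < n)%N -> mx n (scoef f i - scoef g i)) ->
  mx n (seval x f - seval x g).
Proof.
move=> fg; apply: (mx_trans (sevalP f n)).
apply: (mx_trans _ (mxBC (sevalP g n))); rewrite -sumrB; apply: mx_sum => i _.
by rewrite -mulrBl; apply/mxMr/fg.
Qed.

Lemma seval_horner f n : \sum_(i < n) scoef f i * x ^+ i = (series_trunc n f).[x].
Proof. by rewrite horner_poly. Qed.

Fact seval_is_zmod_morphism : zmod_morphism (seval x).
Proof.
move=> f g; apply: sevalE => n.
have -> : \sum_(i < n) scoef (f - g) i * x ^+ i =
    \sum_(i < n) scoef f i * x ^+ i - \sum_(i < n) scoef g i * x ^+ i.
  by rewrite -sumrB; apply: eq_bigr => i _; rewrite scoefB mulrBl.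
by rewrite opprD addrACA -opprD; apply: mxB; apply: sevalP.
Qed.

Fact seval_is_monoid_morphism : monoid_morphism (seval x).
Proof.
split=> [|f g].
  apply: sevalE => -[|n] //; rewrite big_ord_recl /= scoef1 mul1r expr0.
  rewrite big1 ?addr0 ?subrr; first exact: mx0.
  by move=> i _; rewrite scoef1 mul0r.
apply: sevalE => n; apply: (@mx_trans _ _ ((series_trunc n f * series_trunc n g).[x])).
  have sP h : mx n (seval x h - (series_trunc n h).[x]).
    by rewrite -seval_horner; apply: sevalP.
  rewrite hornerM; have -> (a b a' b' : A) :
      a * b - a' * b' = (a - a') * b + a' * (b - b').
    by rewrite mulrBl mulrBr addrA subrK.
  by apply: mxD; [apply: mxMr | apply: mxMl].
rewrite seval_horner -hornerN -hornerD horner_coef; apply: mx_sum => i _.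
rewrite coefB; case: (ltnP i n) => [lt_in|le_ni]; last exact/mxMl/mxXn.
rewrite (agreeM (@agree_trunc _ _ _) (@agree_trunc _ _ _) lt_in).
by rewrite coef_trunc // subrr mul0r; apply: mx0.
Qed.

Lemma sevalC c : seval x (seriesC c) = c.
Proof.
apply: sevalE => -[|n] //; rewrite big_ord_recl /= mulr1.
rewrite big1 ?addr0 ?subrr; first exact: mx0.
by move=> i _; rewrite mul0r.
Qed.

Lemma sevalX : seval x seriesX = x.
Proof.
apply: sevalE => -[|[|n]] //; first by rewrite big_ord1 mul0r subr0; apply/mx1E.
rewrite !big_ord_recl /= mul0r add0r mul1r expr1.
rewrite big1 ?addr0 ?subrr; first exact: mx0.
by move=> i _; rewrite scoefE mul0r.
Qed.

Lemma seval_max f : scoef f 0 \in max_ideal A -> seval x f \in max_ideal A.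
Proof.
move=> f0; apply/mx1E; have := sevalP f 1; rewrite big_ord1 mulr1.
by move=> /mxD h; rewrite -[seval _ _](subrK (scoef f 0)); apply: h; apply/mx1E.
Qed.

End Limits.

Section SevalMorphism.
Variables (A : completeLocalRingType) (x : A) (xm : x \in max_ideal A).
(* Evaluation is a morphism only at points of the maximal ideal, hence the
   dummy argument. *)
Definition sevalm of x \in max_ideal A := seval x.
HB.instance Definition _ := GRing.isZmodMorphism.Build {series A} A
  (sevalm xm) (seval_is_zmod_morphism xm).
HB.instance Definition _ := GRing.isMonoidMorphism.Build {series A} A
  (sevalm xm) (seval_is_monoid_morphism xm).
End SevalMorphism.

Lemma seval_map (A B : completeLocalRingType) (f : {rmorphism A -> B}) x s :
  local_hom f -> x \in max_ideal A -> f (seval x s) = seval (f x) (smap f s).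
Proof.
move=> fl xm; apply/esym/sevalE => [|n]; first exact: fl.
have -> : \sum_(i < n) scoef (smap f s) i * f x ^+ i =
    f (\sum_(i < n) scoef s i * x ^+ i).
  by rewrite rmorph_sum; apply: eq_bigr => i _; rewrite rmorphM rmorphXn.
by rewrite -rmorphB; apply/mx_map/sevalP.
Qed.

(* [{series {series E}}] is E[[X]][[Y]]: the outer index is the exponent of Y.
   Likewise [{series {series {series E}}}] is E[[X]][[Y]][[Z]]. *)
Definition scoef2 (E : Type) (f : {series {series E}}) i j : E :=
  scoef (scoef f j) i.

Definition scoef3 (E : Type) (f : {series {series {series E}}}) i j k : E :=
  scoef (scoef (scoef f k) j) i.

Section Substitution.
Variable E : comNzRingType.
Local Notation S3 := {series {series {series E}}}.

Definition varX : S3 := seriesC (seriesC seriesX).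
Definition varY : S3 := seriesC seriesX.
Definition varZ : S3 := seriesX.

(* f(g, h) for g and h without constant term: the monomials of g ^+ a * h ^+ b
   then have total degree at least a + b, so the finite sum below computes the
   coefficient of X^i Y^j Z^k in the infinite sum of the f_(a,b) g^a h^b. *)
Definition subst2 (f : {series {series E}}) (g h : S3) : S3 :=
  Series (fun k => Series (fun j => Series (fun i =>
    \sum_(a < (i + j + k).+1) \sum_(b < (i + j + k).+1)
      scoef2 f a b * scoef3 (g ^+ a * h ^+ b) i j k))).

End Substitution.
Arguments varX {E}.
Arguments varY {E}.
Arguments varZ {E}.

(* Given commutativity, F(X, 0) = X also gives F(0, Y) = Y. *)
Record fgl (E : comNzRingType) := FGL {
  fgl_series :> {series {series E}};
  fgl_unit : forall i, scoef2 fgl_series i 0 = (i == 1)%:R;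
  fgl_comm : forall i j, scoef2 fgl_series i j = scoef2 fgl_series j i;
  fgl_assoc : subst2 fgl_series (subst2 fgl_series varX varY) varZ =
              subst2 fgl_series varX (subst2 fgl_series varY varZ) }.

Section Order.
Variable E : comNzRingType.
Implicit Types s t : {series {series {series E}}}.

Definition order_ge n s := forall i j k, (i + j + k < n)%N -> scoef3 s i j k = 0.

Lemma order_geM n n' s t :
  order_ge n s -> order_ge n' t -> order_ge (n + n') (s * t).
Proof.
move=> ns nt i j k lt_ijk; rewrite /scoef3 scoefM scoef_sum scoef_sum.
apply: big1 => -[k' /= lk] _; rewrite scoefM scoef_sum; apply: big1 => -[j' /= lj] _.
rewrite scoefM; apply: big1 => -[i' /= li] _; rewrite !ltnS in lk lj li.
have [lt_n|le_n] := ltnP (i' + j' + k') n.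
  by have := ns _ _ _ lt_n; rewrite /scoef3 => ->; rewrite mul0r.
have lt_n' : (i - i' + (j - j') + (k - k') < n')%N.
  rewrite -(ltn_add2l n); apply: leq_ltn_trans lt_ijk.
  apply: leq_trans (leq_add le_n (leqnn _)) _.
  by rewrite addnACA (addnACA i') !subnKC.
by have := nt _ _ _ lt_n'; rewrite /scoef3 => ->; rewrite mulr0.
Qed.

Lemma order_geX n s : order_ge 1 s -> order_ge n (s ^+ n).
Proof.
by move=> s1; elim: n => // n IHn; rewrite exprS -add1n; apply: order_geM.
Qed.

Lemma order_ge1 s : scoef3 s 0 0 0 = 0 -> order_ge 1 s.
Proof. by move=> s0 [|i] [|j] [|k]. Qed.

End Order.

Section FormalAddition.
Variables (E : comNzRingType) (F : fgl E).
Variables (A : completeLocalRingType) (phi : {rmorphism E -> A}).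
Implicit Types x y z : A.
Local Notation m := (max_ideal A).
Local Notation mx := (max_exp A).

(* the value at (x, y) of the image of a series f in E[[X]][[Y]] *)
Definition seval2 (f : {series {series E}}) x y : A :=
  seval y (smap (seval x) (smap (smap phi) f)).

Definition fadd x y : A := seval2 F x y.

Lemma seval2P f x y n : x \in m -> y \in m ->
  mx n (seval2 f x y
        - \sum_(j < n) \sum_(i < n) phi (scoef2 f i j) * x ^+ i * y ^+ j).
Proof.
move=> xm ym; apply: (mx_trans (sevalP ym _ n)).
rewrite -sumrB; apply: mx_sum => j _; rewrite -mulr_suml -mulrBl; apply: mxMr.
exact: sevalP.
Qed.

Section Eval3.
Variables (x y z : A).
Hypotheses (xm : x \in m) (ym : y \in m) (zm : z \in m).

Let ex : {rmorphism {series E} -> A} := sevalm xm \o smap phi.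
Let ey : {rmorphism {series {series E}} -> A} := sevalm ym \o smap ex.
Definition eval3 : {rmorphism {series {series {series E}}} -> A} :=
  sevalm zm \o smap ey.

Let exE s : ex s = seval x (smap phi s). Proof. by []. Qed.
Let eyE s : ey s = seval y (smap ex s). Proof. by []. Qed.
Let ezE s : eval3 s = seval z (smap ey s). Proof. by []. Qed.
Let exC c : ex (seriesC c) = phi c.
Proof. by rewrite exE smapC sevalC. Qed.
Let eyC c : ey (seriesC c) = ex c.
Proof. by rewrite eyE smapC sevalC. Qed.
Let ezC c : eval3 (seriesC c) = ey c.
Proof. by rewrite ezE smapC sevalC. Qed.

Lemma eval3C c : eval3 (seriesC (seriesC (seriesC c))) = phi c.
Proof. by rewrite ezC eyC exC. Qed.
Lemma eval3X : eval3 varX = x.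
Proof. by rewrite ezC eyC exE smapX sevalX. Qed.
Lemma eval3Y : eval3 varY = y.
Proof. by rewrite ezC eyE smapX sevalX. Qed.
Lemma eval3Z : eval3 varZ = z.
Proof. by rewrite ezE smapX sevalX. Qed.

Lemma eval3_congr n s t :
  (forall i j k, (i < n)%N -> (j < n)%N -> (k < n)%N ->
    scoef3 s i j k = scoef3 t i j k) -> mx n (eval3 s - eval3 t).
Proof.
move=> st; apply: seval_congr => // k lt_k; rewrite !scoef_map.
apply: seval_congr => // j lt_j; rewrite !scoef_map.
apply: seval_congr => // i lt_i; rewrite !scoef_map.
have := st i j k lt_i lt_j lt_k; rewrite /scoef3 => ->.
by rewrite subrr; apply: mx0.
Qed.

Lemma eval3_max s : scoef3 s 0 0 0 = 0 -> eval3 s \in m.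
Proof.
move=> s0; apply: seval_max => //; apply: seval_max => //.
apply: seval_max => //; rewrite !scoef_map /=.
by move: s0; rewrite /scoef3 => ->; rewrite rmorph0 rpred0.
Qed.

Lemma eval3_subst f g h : scoef3 g 0 0 0 = 0 -> scoef3 h 0 0 0 = 0 ->
  eval3 (subst2 f g h) = seval2 f (eval3 g) (eval3 h).
Proof.
move=> g0 h0; apply: adic_eq => n; pose M := (n + n + n)%N.
have le_nM : (n <= M)%N by rewrite /M -addnA leq_addr.
pose P := \sum_(b < M) \sum_(a < M)
  seriesC (seriesC (seriesC (scoef2 f a b))) * (g ^+ a * h ^+ b).
apply: (@mx_trans _ n (eval3 P)); last first.
  apply/mxBC/(mx_leq le_nM).
  have := seval2P f M (eval3_max g0) (eval3_max h0).
  congr (mx M (_ - _)); rewrite rmorph_sum; apply: eq_bigr => b _.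
  rewrite rmorph_sum; apply: eq_bigr => a _.
  by rewrite rmorphM eval3C rmorphM !rmorphXn mulrA.
apply: eval3_congr => i j k li lj lk.
have lt_M : (i + j + k < M)%N.
  by rewrite /M -addnS; apply: leq_add => //; apply: leq_add; apply: ltnW.
have -> : scoef3 P i j k = \sum_(b < M) \sum_(a < M)
    scoef2 f a b * scoef3 (g ^+ a * h ^+ b) i j k.
  rewrite /scoef3 /P !scoef_sum; apply: eq_bigr => b _; rewrite !scoef_sum.
  by apply: eq_bigr => a _; rewrite !scoefCM.
have -> : scoef3 (subst2 f g h) i j k =
    \sum_(a < (i + j + k).+1) \sum_(b < (i + j + k).+1)
      scoef2 f a b * scoef3 (g ^+ a * h ^+ b) i j k by [].
rewrite exchange_big /=.
have t0 a b : (i + j + k < a + b)%N ->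
    scoef2 f a b * scoef3 (g ^+ a * h ^+ b) i j k = 0.
  move=> lt_ab; have gX := @order_geX _ a g (order_ge1 g0).
  have hX := @order_geX _ b h (order_ge1 h0).
  by rewrite (order_geM gX hX lt_ab) mulr0.
rewrite (big_ord_widen M (fun b => \sum_(a < (i + j + k).+1)
  (scoef2 f a b * scoef3 (g ^+ a * h ^+ b) i j k))) // big_mkcond /=.
apply: eq_bigr => b _.
case: ltnP => lt_b; last first.
  by rewrite big1 // => a _; rewrite t0 // ltn_addl.
rewrite (big_ord_widen M (fun a =>
  (scoef2 f a b * scoef3 (g ^+ a * h ^+ b) i j k))) // big_mkcond /=.
apply: eq_bigr => a _; case: ltnP => // lt_a.
by rewrite t0 // ltn_addr.
Qed.

End Eval3.

Lemma fgl_const : scoef2 F 0 0 = 0. Proof. exact: fgl_unit. Qed.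

Lemma fadd_max x y : x \in m -> y \in m -> fadd x y \in m.
Proof.
move=> xm ym; apply: seval_max => //; apply: seval_max => //.
rewrite !scoef_map -[scoef _ _]/(scoef2 F 0 0) fgl_const rmorph0.
exact: rpred0.
Qed.

Lemma faddC x y : x \in m -> y \in m -> fadd x y = fadd y x.
Proof.
move=> xm ym; apply: adic_eq => n; apply: (mx_trans (seval2P F n xm ym)).
apply/mxBC; have := seval2P F n ym xm; congr (mx n (_ - _)).
rewrite exchange_big; apply: eq_bigr => j _; apply: eq_bigr => i _.
by rewrite fgl_comm mulrAC.
Qed.

Lemma fadd_subst_const g h : scoef3 (subst2 F g h) 0 0 0 = 0.
Proof. by rewrite /scoef3 !scoefE !big_ord1 fgl_const mul0r. Qed.

Lemma faddA x y z : x \in m -> y \in m -> z \in m ->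
  fadd x (fadd y z) = fadd (fadd x y) z.
Proof.
move=> xm ym zm.
have X0 : scoef3 (varX : {series {series {series E}}}) 0 0 0 = 0 by [].
have Y0 : scoef3 (varY : {series {series {series E}}}) 0 0 0 = 0 by [].
have Z0 : scoef3 (varZ : {series {series {series E}}}) 0 0 0 = 0 by [].
have [e [eX eY eZ eS]] : exists e : {series {series {series E}}} -> A,
    [/\ e varX = x, e varY = y, e varZ = z & forall g h,
      scoef3 g 0 0 0 = 0 -> scoef3 h 0 0 0 = 0 ->
      e (subst2 F g h) = fadd (e g) (e h)].
  exists (eval3 xm ym zm); split.
  - exact: eval3X.
  - exact: eval3Y.
  - exact: eval3Z.
  - by move=> g h; apply: eval3_subst.
have eYZ : e (subst2 F varY varZ) = fadd y z by rewrite eS // eY eZ.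
have eXY : e (subst2 F varX varY) = fadd x y by rewrite eS // eX eY.
have eR := etrans (eS _ _ X0 (fadd_subst_const varY varZ)) (congr2 fadd eX eYZ).
have eL := etrans (eS _ _ (fadd_subst_const varX varY) Z0) (congr2 fadd eXY eZ).
exact: etrans (esym eR) (etrans (esym (congr1 e (fgl_assoc F))) eL).
Qed.

Lemma fadd0 x : x \in m -> fadd x 0 = x.
Proof.
move=> xm; have zm : 0 \in m by apply: rpred0.
rewrite /fadd /seval2; set s := smap _ _.
have -> : seval 0 s = scoef s 0.
  apply: sevalE => // -[|n] //; rewrite big_ord_recl mulr1 big1 ?addr0 ?subrr.
    exact: mx0.
  by move=> i _; rewrite expr0n mulr0.
rewrite scoef_map -[RHS](sevalX xm); congr seval; apply: seriesP => i.
by rewrite !scoef_map -[scoef _ _]/(scoef2 F i 0) fgl_unit rmorph_nat.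
Qed.

Lemma fadd_lipschitz x y y' n : x \in m -> y \in m -> y' \in m ->
  mx n (y - y') -> mx n.+1 ((y - fadd x y) - (y' - fadd x y')).
Proof.
move=> xm ym ym' yy'.
pose s := smap (seval x) (smap (smap phi) F).
pose t := seriesX - s.
have te w : w \in m -> w - fadd x w = seval w t.
  by move=> wm; rewrite (seval_is_zmod_morphism wm) sevalX.
have tm j : scoef t j \in m.
  apply/mx1E/mxBC; rewrite /s scoef_map.
  have := sevalP xm (scoef (smap (smap phi) F) j) 1.
  rewrite big_ord1 mulr1 !scoef_map -[scoef _ 0]/(scoef2 F 0 j).
  by rewrite fgl_comm fgl_unit rmorph_nat.
rewrite !te //; apply: (mx_trans (sevalP ym t _)).
apply: (mx_trans _ (mxBC (sevalP ym' t _))).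
rewrite -sumrB; apply: mx_sum => j _; rewrite -mulrBr; apply: mxS => //.
by rewrite subrXX; apply: mxMr.
Qed.

Lemma fadd_inverse x : x \in m -> exists2 y, y \in m & fadd x y = 0.
Proof.
move=> xm; pose T y := y - fadd x y; pose Y n := iter n T 0.
have Tm y : y \in m -> T y \in m.
  by move=> ym; rewrite rpredB // fadd_max.
have Ym n : Y n \in m by elim: n => [|n /Tm]; first exact: rpred0.
have YS n : mx n (Y n.+1 - Y n).
  elim: n => // n IHn.
  exact: (fadd_lipschitz xm (Ym n.+1) (Ym n) IHn).
have [l lY] := adic_complete Y YS.
have lm : l \in m.
  by rewrite -[l](subrK (Y 1)) rpredD //; apply/mx1E/lY.
exists l => //; apply: adic_eq => n; rewrite subr0 -[fadd x l](subKr l).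
apply: mxW; apply: (mx_trans (lY n.+1)).
exact: (fadd_lipschitz xm (Ym n) lm (mxBC (lY n))).
Qed.

End FormalAddition.

Record local_alg_hom (R : localRingType) (A B : completeLocalAlgType R) :=
  LocalAlgHom {
    local_alg_mor :> {lrmorphism A -> B};
    local_alg_homP : local_hom local_alg_mor }.

(* F(A): the maximal ideal of A, to be given the group law of F; the addition is
   [fpt_add], not the one of A. *)
Record fpts (E : localRingType) (F : fgl E)
    (A : completeLocalAlgType {series E}) := FPoint {
  fpt_val : A;
  fpt_max : fpt_val \in max_ideal A }.

Section Points.
Variables (E : localRingType) (F : fgl E).
Variable A : completeLocalAlgType {series E}.

HB.instance Definition _ := [isSub for @fpt_val E F A].
HB.instance Definition _ := [Choice of fpts F A by <:].

Definition coef_hom : {rmorphism E -> A} := in_alg A \o @seriesC E.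

Implicit Types x y z : fpts F A.

Definition fpt_add x y : fpts F A :=
  FPoint F (fadd_max F coef_hom (fpt_max x) (fpt_max y)).

Definition fpt_zero : fpts F A := FPoint F (rpred0 (max_ideal A)).

(* Inverses are not part of [fgl]; they exist by successive approximation. *)
Fact fpt_inverse x : exists y, fpt_add x y = fpt_zero.
Proof.
have [y ym xy] := fadd_inverse F coef_hom (fpt_max x).
by exists (FPoint F ym); apply: val_inj.
Qed.
Definition fpt_opp x : fpts F A := projT1 (cid (fpt_inverse x)).

Fact fpt_addA : associative fpt_add.
Proof. by move=> x y z; apply: val_inj; apply: faddA; apply: fpt_max. Qed.
Fact fpt_addC : commutative fpt_add.
Proof. by move=> x y; apply: val_inj; apply: faddC; apply: fpt_max. Qed.
Fact fpt_add0 : left_id fpt_zero fpt_add.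
Proof.
by move=> x; rewrite fpt_addC; apply: val_inj; apply: fadd0; apply: fpt_max.
Qed.
Fact fpt_addN : left_inverse fpt_zero fpt_opp fpt_add.
Proof. by move=> x; rewrite fpt_addC /fpt_opp; case: cid. Qed.

HB.instance Definition _ := GRing.isZmodule.Build (fpts F A)
  fpt_addA fpt_addC fpt_add0 fpt_addN.

Lemma fpt_valD x y : fpt_val (x + y) = fadd F coef_hom (fpt_val x) (fpt_val y).
Proof. by []. Qed.

Definition qhat : fpts F A := FPoint F (in_alg_local seriesX (seriesX_max E)).

End Points.

Section PointsMap.
Variables (E : localRingType) (F : fgl E).
Variables (A B : completeLocalAlgType {series E}) (f : local_alg_hom A B).

Definition fpts_map (x : fpts F A) : fpts F B :=
  FPoint F (local_alg_homP f (fpt_max x)).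

Fact fpts_map_is_zmod_morphism : zmod_morphism fpts_map.
Proof.
suff fD : {morph fpts_map : x y / x + y}.
  by move=> x y; apply/(addIr (fpts_map y)); rewrite -fD !subrK.
move=> x y; apply: val_inj.
rewrite /= /fadd /seval2 (seval_map _ (local_alg_homP f) (fpt_max y)).
congr seval; apply: seriesP => j; rewrite !scoef_map.
rewrite (seval_map _ (local_alg_homP f) (fpt_max x)).
congr seval; apply: seriesP => i; rewrite !scoef_map /=.
by rewrite linearZ rmorph1.
Qed.
HB.instance Definition _ := GRing.isZmodMorphism.Build (fpts F A) (fpts F B)
  fpts_map fpts_map_is_zmod_morphism.

Lemma fpts_map_qhat : fpts_map (qhat F A) = qhat F B.
Proof. by apply: val_inj; rewrite /= linearZ rmorph1. Qed.

End PointsMap.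

Definition torsion (G : zmodType) : {pred G} :=
  [pred x | `[< exists n, (0 < n)%N /\ x *+ n = 0 >]].
Arguments torsion : clear implicits.

Fact torsion_zmod_closed (G : zmodType) : zmod_closed (torsion G).
Proof.
split=> [|x y /asboolP[n [n0 xn]] /asboolP[k [k0 yk]]]; apply/asboolP.
  by exists 1; rewrite mul0rn.
exists (n * k)%N; rewrite muln_gt0 n0 k0; split=> //.
by rewrite mulrnBl mulrnA xn mul0rn mulnC mulrnA yk mul0rn subr0.
Qed.
HB.instance Definition _ (G : zmodType) :=
  GRing.isZmodClosed.Build G (torsion G) (torsion_zmod_closed G).

Record tors (G : zmodType) := Tors {
  tors_val : G;
  torsP : tors_val \in torsion G }.
HB.instance Definition _ (G : zmodType) := [isSub for @tors_val G].
HB.instance Definition _ (G : zmodType) := [Choice of tors G by <:].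
HB.instance Definition _ (G : zmodType) :=
  [SubChoice_isSubZmodule of tors G by <:].

Section TorsMap.
Variables (G H : zmodType) (f : {additive G -> H}).

Fact tors_map_subproof (x : tors G) : f (tors_val x) \in torsion H.
Proof.
have /asboolP[n [n0 xn]] := torsP x.
by apply/asboolP; exists n; rewrite -raddfMn xn raddf0.
Qed.
Definition tors_map (x : tors G) : tors H := Tors (tors_map_subproof x).

Fact tors_map_is_zmod_morphism : zmod_morphism tors_map.
Proof. by move=> x y; apply: val_inj; rewrite /= raddfB. Qed.
HB.instance Definition _ := GRing.isZmodMorphism.Build (tors G) (tors H)
  tors_map tors_map_is_zmod_morphism.
End TorsMap.

Definition cyclic_sub (G : zmodType) (q : G) : {pred G} :=
  [pred x | `[< exists n : int, x = q *~ n >]].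

Fact cyclic_sub_zmod_closed (G : zmodType) (q : G) :
  zmod_closed (cyclic_sub q).
Proof.
split=> [|x y /asboolP[n ->] /asboolP[k ->]]; apply/asboolP.
  by exists 0.
by exists (n - k); rewrite mulrzBr.
Qed.
HB.instance Definition _ (G : zmodType) (q : G) :=
  GRing.isZmodClosed.Build G (cyclic_sub q) (cyclic_sub_zmod_closed q).

Definition quot_cyclic (G : zmodType) (q : G) := Quotient.quot (cyclic_sub q).
HB.instance Definition _ (G : zmodType) (q : G) :=
  GRing.Zmodule.on (quot_cyclic q).

Definition quot_proj (G : zmodType) (q x : G) : quot_cyclic q :=
  \pi_(Quotient.quot (cyclic_sub q))%qT x.

Section QuotientProj.
Variables (G : zmodType) (q : G).

Lemma quot_proj_eq x y :
  (quot_proj q x = quot_proj q y) <-> (exists n : int, x - y = q *~ n).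
Proof.
rewrite /quot_proj; split=> [/eqP|[n e]].
  by rewrite -Quotient.idealrBE => /asboolP.
by apply/eqP; rewrite -Quotient.idealrBE; apply/asboolP; exists n.
Qed.

Fact quot_proj_is_zmod_morphism : zmod_morphism (quot_proj q).
Proof. by move=> x y; rewrite /quot_proj raddfB. Qed.
HB.instance Definition _ := GRing.isZmodMorphism.Build G (quot_cyclic q)
  (quot_proj q) quot_proj_is_zmod_morphism.

Lemma quot_proj_surj (u : quot_cyclic q) : exists x, quot_proj q x = u.
Proof. by exists (repr u); apply: reprK. Qed.

End QuotientProj.

Section QuotientMap.
Variables (G H : zmodType) (q : G) (r : H) (f : {additive G -> H}).
Hypothesis fq : f q = r.

(* Defined for any f; the dummy argument makes it a morphism. *)
Definition quot_map of f q = r := fun u : quot_cyclic q =>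
  quot_proj r (f (repr u)).

Lemma quot_map_proj x : quot_map fq (quot_proj q x) = quot_proj r (f x).
Proof.
apply/quot_proj_eq; have : quot_proj q (repr (quot_proj q x)) = quot_proj q x.
  exact: reprK.
move=> /quot_proj_eq[n e]; exists n.
by rewrite -raddfB e raddfMz fq.
Qed.

Fact quot_map_is_zmod_morphism : zmod_morphism (quot_map fq).
Proof.
move=> u v; have [[x <-] [y <-]] := (quot_proj_surj u, quot_proj_surj v).
by rewrite -raddfB !quot_map_proj !raddfB.
Qed.
HB.instance Definition _ := GRing.isZmodMorphism.Build
  (quot_cyclic q) (quot_cyclic r) (quot_map fq) quot_map_is_zmod_morphism.
End QuotientMap.

(* Pairs (g, a) with a rational in [0, 1); [tate_mul] twists by q when the second
   components carry. Tate(F)(A) is the case G = F(A), q = qhat. *)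
Record tate (G : zmodType) (q : G) := TatePt {
  tate_pair : G * rat;
  tate_bound : 0 <= tate_pair.2 < 1 }.

Section Tate.
Variables (G : zmodType) (q : G).
HB.instance Definition _ := [isSub for @tate_pair G q].
HB.instance Definition _ := [Choice of tate q by <:].
Implicit Types u v w : tate q.

Lemma tateP u v : (tate_pair u).1 = (tate_pair v).1 ->
  (tate_pair u).2 = (tate_pair v).2 -> u = v.
Proof.
move=> e1 e2; apply: val_inj => /=.
by case: (tate_pair u) (tate_pair v) e1 e2 => [g a] [h b] /= -> ->.
Qed.

Definition tate_mul_pair (x y : G * rat) : G * rat :=
  if x.2 + y.2 < 1 then (x.1 + y.1, x.2 + y.2)
  else (x.1 + y.1 - q, x.2 + y.2 - 1).

Fact tate_mul_bound u v :
  0 <= (tate_mul_pair (tate_pair u) (tate_pair v)).2 < 1.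
Proof.
rewrite /tate_mul_pair; case: u v => -[g a] /= ab [[h b] /= bb].
by case: ltP => ?; apply/andP; split => /=; lra.
Qed.
Definition tate_mul u v : tate q := TatePt q (tate_mul_bound u v).

Fact tate_one_bound : 0 <= (0 : G, 0 : rat).2 < 1. Proof. by []. Qed.
Definition tate_one : tate q := TatePt q tate_one_bound.

Definition tate_inv_pair (x : G * rat) : G * rat :=
  if x.2 == 0 then (- x.1, 0) else (q - x.1, 1 - x.2).

Fact tate_inv_bound u : 0 <= (tate_inv_pair (tate_pair u)).2 < 1.
Proof.
rewrite /tate_inv_pair; case: u => -[g a] /= ab.
by case: eqP => //= a0; apply/andP; split; lra.
Qed.
Definition tate_inv u : tate q := TatePt q (tate_inv_bound u).

Fact tate_mulC : commutative tate_mul.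
Proof.
move=> u v; apply: val_inj => /=; rewrite /tate_mul_pair.
by rewrite (addrC (tate_pair v).1) (addrC (tate_pair v).2).
Qed.

Fact tate_mulA : associative tate_mul.
Proof.
case=> -[g a] /= ab [[h b] /= bb] [[k c] /= cb].
apply: val_inj; rewrite /= /tate_mul_pair /=.
have gE1 : g + (h + k - q) = g + h - q + k by rewrite !addrA addrAC.
have gE2 : g + (h + k) = g + h + k by rewrite addrA.
have gE3 : g + (h + k - q) = g + h + k - q by rewrite !addrA.
case: (ltP (b + c) 1) => ? /=; case: (ltP (a + b) 1) => ? /=;
  case: ltP => ?; case: ltP => ?; try (exfalso; lra).
- by rewrite gE2 addrA.
- by rewrite gE2 addrA.
- by rewrite gE2 -gE1 gE3; congr (_, _); lra.
- by rewrite gE3; congr (_, _); lra.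
- by rewrite gE1; congr (_, _); lra.
- by rewrite gE1; congr (_, _); lra.
Qed.

Fact tate_mul1 : left_id tate_one tate_mul.
Proof.
move=> u; apply: val_inj; rewrite /= /tate_mul_pair !add0r.
by case: u => -[g a] /= /andP[_ ->].
Qed.

Fact tate_mulV : left_inverse tate_one tate_inv tate_mul.
Proof.
move=> u; apply: val_inj; rewrite /= /tate_mul_pair /tate_inv_pair.
case: u => -[g a] /= ab; case: eqP => [-> | a0] /=.
  by rewrite addr0 addNr.
by rewrite !subrK ltxx !subrr.
Qed.

HB.instance Definition _ := GRing.isZmodule.Build (tate q)
  tate_mulA tate_mulC tate_mul1 tate_mulV.

(* The surjection G * Q -> tate q with kernel generated by (q, 1). *)
Definition tate_proj_pair (x : G * rat) : G * rat :=
  (x.1 - q *~ Num.floor x.2, x.2 - (Num.floor x.2)%:~R).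

Fact tate_proj_bound x : 0 <= (tate_proj_pair x).2 < 1.
Proof.
rewrite subr_ge0 floor_le /= ltrBlDl.
by have := floorD1_gt x.2; rewrite intrD.
Qed.
Definition tate_proj (x : G * rat) : tate q := TatePt q (tate_proj_bound x).

Fact tate_proj_is_zmod_morphism : zmod_morphism tate_proj.
Proof.
suff tD : {morph tate_proj : x y / x + y}.
  by move=> x y; apply/(addIr (tate_proj y)); rewrite -tD !subrK.
move=> [g a] [h b]; apply: val_inj.
have := tate_proj_bound (g + h, a + b).
have := tate_proj_bound (g, a); have := tate_proj_bound (h, b).
rewrite /= /tate_mul_pair /tate_proj_pair /=.
set i := Num.floor a; set j := Num.floor b; set k := Num.floor (a + b).
move=> bb ab sb; case: ltP => lt1.
  have -> : k = i + j by apply: floor_def; rewrite !intrD; lra.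
  by congr (_, _); [rewrite mulrzDr opprD addrACA | rewrite intrD; lra].
have -> : k = i + j + 1 by apply: floor_def; rewrite !intrD; lra.
congr (_, _); last by rewrite !intrD; lra.
by rewrite !mulrzDr mulr1z opprD addrA opprD addrACA.
Qed.
HB.instance Definition _ := GRing.isZmodMorphism.Build (G * rat)%type (tate q)
  tate_proj tate_proj_is_zmod_morphism.

Lemma tate_proj_surj u : tate_proj (tate_pair u) = u.
Proof.
apply: val_inj; case: u => -[g a] /= ab; rewrite /tate_proj_pair /=.
by rewrite (@floor_def _ a 0) ?mulr0z ?subr0.
Qed.

Lemma tate_proj_ker x :
  tate_proj x = 0 <-> exists n : int, x = (q *~ n, n%:~R).
Proof.
case: x => g a; split=> [/(congr1 val)[/= e1 e2]|[n [-> ->]]].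
  exists (Num.floor a); congr (_, _).
    by apply/eqP; rewrite -subr_eq0 e1.
  by apply/eqP; rewrite -subr_eq0 e2.
by apply: val_inj; rewrite /= /tate_proj_pair /= intrKfloor !subrr.
Qed.

End Tate.

Section TateMap.
Variables (G H : zmodType) (q : G) (r : H) (f : {additive G -> H}).
Hypothesis fq : f q = r.

Fact tate_map_bound (u : tate q) :
  0 <= (f (tate_pair u).1, (tate_pair u).2).2 < 1.
Proof. exact: (tate_bound u). Qed.
Definition tate_map of f q = r := fun u : tate q => TatePt r (tate_map_bound u).

Fact tate_map_is_zmod_morphism : zmod_morphism (tate_map fq).
Proof.
suff tD : {morph tate_map fq : x y / x + y}.
  by move=> x y; apply/(addIr (tate_map fq y)); rewrite -tD !subrK.
move=> u v; apply: val_inj; rewrite /= /tate_mul_pair /=.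
by case: ltP => _ /=; rewrite ?raddfB raddfD ?fq.
Qed.
HB.instance Definition _ := GRing.isZmodMorphism.Build (tate q) (tate r)
  (tate_map fq) tate_map_is_zmod_morphism.
End TateMap.

Section Functors.
Variables (E : localRingType) (F : fgl E).
Local Notation algebra := (completeLocalAlgType {series E}).

Definition Tate (A : algebra) : zmodType := tate (qhat F A).
Definition Fquot (A : algebra) : zmodType := quot_cyclic (qhat F A).

Variables (A B : algebra) (f : local_alg_hom A B).

Definition Tate_map : {additive Tate A -> Tate B} :=
  tate_map (fpts_map_qhat F f).
Definition Fquot_map : {additive Fquot A -> Fquot B} :=
  quot_map (fpts_map_qhat F f).

End Functors.

(* Main.v *)
Require Import Defs.
From mathcomp Require Import all_boot all_order all_algebra.
From HB Require Import structures.
From mathcomp Require Import boolp.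
Import GRing.Theory.
Set Implicit Arguments.
Local Open Scope ring_scope.

(** A pair (x, a) in G * Q is torsion modulo (q, 1) iff N x = m q and N a = m
    for some integers N > 0 and m.  If N x = m q, then a := m / N lifts the class
    of x; and when q is not torsion, m is determined by N and x, hence a = m / N
    is determined by x. *)

Section TateQuotient.
Variables (G : zmodType) (q : G).

(** Passing to the quotient is what makes this additive: a carry in [tate_mul] subtracts [q] from
    the first component. *)
Definition tate_quot (u : tate q) : quot_cyclic q :=
  quot_proj q (tate_pair u).1.

Lemma quot_proj_eq0 (x : G) :
  quot_proj q x = 0 <-> exists n : int, x = q *~ n.
Proof. by rewrite -(raddf0 (quot_proj q)) quot_proj_eq subr0. Qed.

(** [tate_proj] moves the first component by an integer multiple of [q], so [tate_quot] is the map
    induced by the first projection of [G * rat]. *)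
Lemma tate_quot_proj (x : G * rat) :
  tate_quot (tate_proj q x) = quot_proj q x.1.
Proof.
apply/quot_proj_eq; exists (- Num.floor x.2).
by rewrite /= addrAC subrr add0r mulrNz.
Qed.

Fact tate_quot_is_zmod_morphism : zmod_morphism tate_quot.
Proof.
(* Lifting to [G * rat], where subtraction is componentwise, avoids cases on carries. *)
move=> u v; rewrite -(tate_proj_surj u) -(tate_proj_surj v) -raddfB.
by rewrite !tate_quot_proj raddfB.
Qed.
HB.instance Definition _ := GRing.isZmodMorphism.Build (tate q)
  (quot_cyclic q) tate_quot tate_quot_is_zmod_morphism.

Lemma nontorsion_mulz_eq0 (n : int) :
  q \notin torsion G -> q *~ n = 0 -> n = 0.
Proof.
move=> qNt; case: (intP n) => // k.
  by move=> qk; case/negP: qNt; apply/asboolP; exists k.+1.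
rewrite mulrNz => /eqP; rewrite oppr_eq0 => /eqP qk.
by case/negP: qNt; apply/asboolP; exists k.+1.
Qed.

Lemma tate_quot_tors_inj :
  q \notin torsion G -> injective (tors_map tate_quot).
Proof.
move=> qNt; apply: raddf_inj => -[u ut] /(congr1 (@tors_val _)) /= u0.
apply: val_inj => /=; move: ut u0 => /asboolP[N [N_gt0]].
rewrite -(tate_proj_surj u) tate_quot_proj; case: (tate_pair u) => x a.
rewrite -raddfMn => /tate_proj_ker[m]; rewrite pairMnE => -[xN aN].
move=> /quot_proj_eq0[n /= xE]; apply/tate_proj_ker; exists n.
rewrite xE; congr (_, _).
(* Both [q *~ m] and [q *~ (n * N)] equal [x *+ N], and [q] has infinite order. Hence
   [N a = m = n N], so [a = n] and the pair is [n] times [(q, 1)]. *)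
have mE : m = n * N%:Z.
  apply/esym/eqP; rewrite -subr_eq0; apply/eqP/nontorsion_mulz_eq0 => //.
  by rewrite mulrzBr -xN xE pmulrn mulrzA subrr.
apply: (@mulIf rat N%:R); first by rewrite Num.Theory.pnatr_eq0 -lt0n.
by rewrite mulr_natr aN mE intrM.
Qed.

Lemma tate_quot_tors_surj (y : tors (quot_cyclic q)) :
  exists t, tors_map tate_quot t = y.
Proof.
have /asboolP[N [N_gt0]] := torsP y.
have [x xy] := quot_proj_surj (tors_val y).
rewrite -xy -raddfMn => /quot_proj_eq0[m xN].
(* The second component is chosen so that [N] times the pair is [m] times [(q, 1)], which
   [tate_proj] kills. *)
have ut : tate_proj q (x, m%:~R / N%:R) \in torsion (tate q).
  apply/asboolP; exists N; split=> //; rewrite -raddfMn; apply/tate_proj_ker.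
  exists m; rewrite pairMnE -xN; congr (_, _).
  by rewrite /= -[LHS]mulr_natr divfK // Num.Theory.pnatr_eq0 -lt0n.
by exists (Tors ut); apply: val_inj; rewrite /= tate_quot_proj.
Qed.

Lemma tate_quot_tors_bij :
  q \notin torsion G -> bijective (tors_map tate_quot).
Proof.
move=> /tate_quot_tors_inj inj.
(* A chosen right inverse of an injective map is also a left inverse. *)
pose g y := projT1 (cid (tate_quot_tors_surj y)).
have gK : cancel g (tors_map tate_quot).
  by move=> y; rewrite /g; case: cid.
by exists g => // t; apply: inj; rewrite gK.
Qed.

End TateQuotient.

Theorem proposition5p1p2 (E : completeLocalRingType) (p : nat)
    (char_p : p \in [pchar (residue_field E)]) (F : fgl E) :
  exists eta : forall A : completeLocalAlgType {series E},
      {additive tors (Tate F A) -> tors (Fquot F A)},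
    [/\ forall (A : completeLocalAlgType {series E}) (x : fpts F A) (a : rat)
          (t : tors (Tate F A)),
          tors_val t = tate_proj (qhat F A) (x, a) ->
          tors_val (eta A t) = quot_proj (qhat F A) x,
        forall (A B : completeLocalAlgType {series E}) (f : local_alg_hom A B)
          (t : tors (Tate F A)),
          eta B (tors_map (Tate_map F f) t) = tors_map (Fquot_map F f) (eta A t)
      & forall A : completeLocalAlgType {series E},
          qhat F A \notin torsion (fpts F A) -> bijective (eta A)].
Proof.
exists (fun A => tors_map (@tate_quot _ (qhat F A))).
split=> [A x a t tE | A B f t | A].
- by rewrite /= tE tate_quot_proj.
(* Both composites send a pair to the class of the image of its first component under [f]. *)
- by apply: val_inj; rewrite /= /Fquot_map /tate_quot /= quot_map_proj.
- exact: tate_quot_tors_bij.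
Qed.
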